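(* Let $\overline p(n)$ denote the number of overpartitions of $n$, i.e. $\sum_{n\ge0}\overline p(n)q^n=\prod_{n\ge1}\frac{1+q^n}{1-q^n}$. Define $c(r)=2$ for $r$ odd and $c(r)=1$ for $r$ even, $\sigma^{(m)}(n)=\sum_{r\mid n}c(r)\,r^m$, and \[ \overline{M}_m(n)=\sum_{d=1}^{n}\sigma^{(m)}(d)\,\overline p(n-d). \] Then for all $n\ge0$: \[ \overline M_5(5n)\equiv0\pmod5,\quad \overline M_7(7n)\equiv0\pmod7,\quad \overline M_{11}(11n)\equiv0\pmod{11},\quad \overline M_{13}(13n)\equiv0\pmod{13}, \] \[ \overline M_9(5n)\equiv0\pmod5,\quad \overline M_{13}(7n)\equiv0\pmod7. \]
   Context: The overpartition generating function is the Euler product $\prod_{r\ge1}(1-q^r)^{-c(r)}$ with the exponent sequence $c(r)$ given in the claim; $\overline M_m(n)$ are the corresponding overpartition frequency moments. *)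

(* Defs.v *)
From mathcomp Require Import all_boot all_order all_algebra.
From mathcomp Require Import ring.

Set Implicit Arguments.
Unset Strict Implicit.
Unset Printing Implicit Defensive.

(* An overpartition of n is a partition of n in which one occurrence of each
   part size that occurs may be overlined.  It is encoded by the function
   sending i to (multiplicity of the part i.+1, whether it is overlined). *)
Definition overpartitions (n : nat) : {set {ffun 'I_n -> 'I_n.+1 * bool}} :=
  [set f : {ffun 'I_n -> 'I_n.+1 * bool} |
    (\sum_(i < n) i.+1 * (f i).1 == n)
    && [forall i, (f i).2 ==> (0 < (f i).1)]].

Definition pbar (n : nat) : nat := #|overpartitions n|.

Definition cexp (r : nat) : nat := if odd r then 2 else 1.

Definition sigma_c (m n : nat) : nat := \sum_(r <- divisors n) cexp r * r ^ m.

Definition Mbar (m n : nat) : nat :=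
  \sum_(1 <= d < n.+1) sigma_c m d * pbar (n - d).

Section GeneratingFunction.

Import GRing.Theory.
Local Open Scope ring_scope.

Local Definition eqX n (p q : {poly int}) := exists s, p - q = s * 'X^(n.+1).

Local Lemma eqX_refl n p : eqX n p p.
Proof. by exists 0; rewrite subrr mul0r. Qed.

Local Lemma eqX_sym n p q : eqX n p q -> eqX n q p.
Proof. by case=> s e; exists (- s); rewrite mulNr -e opprB. Qed.

Local Lemma eqX_trans n q p r : eqX n p q -> eqX n q r -> eqX n p r.
Proof.
by case=> s e [t f]; exists (s + t); rewrite mulrDl -e -f addrA subrK.
Qed.

Local Lemma eqX_mul n p q p' q' :
  eqX n p q -> eqX n p' q' -> eqX n (p * p') (q * q').
Proof.
case=> s e [t f]; exists (s * p' + q * t).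
rewrite mulrDl -(mulrA q) -f (mulrAC s) -e; ring.
Qed.

Local Lemma eqX_coef n p q i : eqX n p q -> (i <= n)%N -> p`_i = q`_i.
Proof.
case=> s e le_in; apply/eqP; rewrite -subr_eq0 -coefB e coefMXn.
by rewrite ltnS le_in.
Qed.

Local Lemma eqX_prod n m (F G : nat -> {poly int}) :
  (forall r, (0 < r <= m)%N -> eqX n (F r) (G r)) ->
  eqX n (\prod_(1 <= r < m.+1) F r) (\prod_(1 <= r < m.+1) G r).
Proof.
move=> FG; rewrite !big_nat.
by elim/big_ind2: _ => [|p q p' q' h1 h2|r /FG //];
   [exact: eqX_refl | exact: eqX_mul].
Qed.

Local Lemma eqX_cut n N (F : nat -> {poly int}) : (n <= N)%N ->
  (forall r, (n < r)%N -> eqX n (F r) 1) ->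
  eqX n (\prod_(1 <= r < N.+1) F r) (\prod_(1 <= r < n.+1) F r).
Proof.
move=> le_nN F1; rewrite (big_cat_nat (n := n.+1)) //=.
rewrite -[X in eqX n _ X]mulr1; apply: eqX_mul; first exact: eqX_refl.
rewrite big_nat; elim/big_ind: _ => [|p q hp hq|r /andP[/F1 //]].
  exact: eqX_refl.
by rewrite -(mulr1 1); apply: eqX_mul.
Qed.

Local Lemma eqX_cancel n (p q d : {poly int}) :
  d`_0 = 1 -> eqX n (p * d) (q * d) -> eqX n p q.
Proof.
move=> d0 e.
have z i : (i <= n)%N -> (p - q)`_i = 0.
  elim/ltn_ind: i => i IH le_in.
  have := eqX_coef e le_in; move/eqP; rewrite -subr_eq0 -coefB -mulrBl.
  rewrite coefM big_ord_recr /= subnn d0 mulr1 big1 ?add0r => [/eqP//|j _].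
  by rewrite IH ?mul0r // (leq_trans _ le_in) // ltnW.
exists (drop_poly n.+1 (p - q)); rewrite -[LHS](poly_take_drop n.+1).
suff -> : take_poly n.+1 (p - q) = 0 by rewrite add0r.
apply/polyP => i; rewrite coef_take_poly coef0 ltnS.
by case: ifP => // /z.
Qed.

Local Definition H N r : {poly int} :=
  \sum_(x : 'I_N.+1 * bool | x.2 ==> (0 < x.1)%N) 'X^(r * x.1).

Local Definition P N : {poly int} := \prod_(i < N) H N i.+1.

Local Lemma HE N r : H N r = 1 + (\sum_(m < N) 'X^(r * m.+1)) *+ 2.
Proof.
rewrite /H -(pair_big_dep xpredT
  (fun (m : 'I_N.+1) (b : bool) => b ==> (0 < m)%N)
  (fun (m : 'I_N.+1) (b : bool) => 'X^(r * m))) /=.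
rewrite big_ord_recl /= -sumrMnl; congr (_ + _).
  by rewrite big_mkcond /= big_bool /= muln0 expr0 add0r.
by apply: eq_bigr => m _; rewrite big_mkcond /= big_bool /= mulr2n.
Qed.

Local Lemma H_eqX N r : (0 < r)%N -> eqX N (H N r * (1 - 'X^r)) (1 + 'X^r).
Proof.
move=> r0.
have -> : H N r * (1 - 'X^r) = 1 + 'X^r - ('X^(r * N.+1)) *+ 2.
  rewrite HE; elim: N => [|N IH]; first by rewrite big_ord0 muln1; ring.
  rewrite big_ord_recr /= mulrnDl addrA mulrDl IH (mulnS r N.+1) exprD; ring.
exists (- 'X^(r * N.+1 - N.+1) *+ 2).
rewrite mulrnAl mulNr -exprD subnK ?leq_pmull //; ring.
Qed.

Local Lemma P_eqX N : eqX N (P N * \prod_(1 <= r < N.+1) (1 - 'X^r))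
                    (\prod_(1 <= r < N.+1) (1 + 'X^r)).
Proof.
have -> : P N = \prod_(1 <= r < N.+1) H N r by rewrite big_add1 /= big_mkord.
by rewrite -big_split /=; apply: eqX_prod => r /andP[r0 _]; apply: H_eqX.
Qed.

Local Lemma pbarE n : (P n)`_n = (pbar n)%:R.
Proof.
rewrite /P /H bigA_distr_big_dep coef_sum.
rewrite /pbar -sum1_card natr_sum [LHS]big_mkcond [RHS]big_mkcond /=.
apply: eq_bigr => f _.
set b := (X in if X then _ else 0).
have -> : b = [forall i, (f i).2 ==> (0 < (f i).1)%N].
  by apply/familyP/forallP.
have -> : \prod_(i < n) 'X^(i.+1 * (f i).1) =
    'X^(\sum_(i < n) i.+1 * (f i).1)%N :> {poly int}.
  by elim/big_rec2: _ => [|i u v _ ->]; rewrite ?expr0 ?exprD.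
by rewrite coefXn eq_sym [in RHS]inE andbC; case: [forall i, _] => //=; case: eqP.
Qed.

(* The identity \sum_n pbar n q^n = \prod_(r >= 1) (1 + q^r) / (1 - q^r),
   with denominators cleared, modulo q^N.+1 for every N. *)
Lemma pbar_genfun (N n : nat) : (n <= N)%N ->
  ((\poly_(i < N.+1) (pbar i)%:R) * \prod_(1 <= r < N.+1) (1 - 'X^r))`_n
  = (\prod_(1 <= r < N.+1) (1 + 'X^r))`_n :> int.
Proof.
move=> le_nN; rewrite -(eqX_coef (P_eqX N) le_nN) !coefM.
apply: eq_bigr => -[j /=]; rewrite ltnS => le_jn _; congr (_ * _).
have le_jN := leq_trans le_jn le_nN.
rewrite coef_poly ltnS le_jN -pbarE.
suff /eqX_coef-> : eqX j (P N) (P j) by [].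
have big1X (e : int) r : (j < r)%N -> eqX j (1 + e *: 'X^r) 1.
  move=> lt_jr; exists (e *: 'X^(r - j.+1)).
  by rewrite -scalerAl -exprD subnK // addrC addKr.
have weak p q : eqX N p q -> eqX j p q.
  case=> s e; exists (s * 'X^(N - j)).
  by rewrite e -mulrA -exprD addnS subnK.
have D r : (j < r)%N -> eqX j (1 - 'X^r) 1.
  by move/(big1X (-1)); rewrite scaleN1r.
have E r : (j < r)%N -> eqX j (1 + 'X^r) 1.
  by move/(big1X 1); rewrite scale1r.
apply: (@eqX_cancel _ _ _ (\prod_(1 <= r < j.+1) (1 - 'X^r))).
  rewrite -horner_coef0 horner_prod big_nat big1 // => r /andP[r0 _].
  by rewrite !hornerE expr0n; case: r r0 => //= r _; rewrite subr0.
apply: (@eqX_trans _ (P N * \prod_(1 <= r < N.+1) (1 - 'X^r))).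
  apply: eqX_mul; first exact: eqX_refl.
  by apply: eqX_sym; apply: eqX_cut.
apply: eqX_trans (weak _ _ (P_eqX N)) _.
apply: eqX_trans (eqX_cut le_jN E) _.
exact: eqX_sym (P_eqX j).
Qed.

End GeneratingFunction.

(* Main.v *)
Require Import Defs.
From mathcomp Require Import all_boot.
From mathcomp Require Import all_algebra ring.

(** By Fermat's little theorem, [r ^ m = r] modulo [p] for every pair [(m, p)]
of the statement, since [p - 1] divides [m - 1]; hence [Mbar m k = Mbar 1 k]
modulo [p]. The generating function of [pbar] is the Euler product with
exponents [cexp] (Euler's identity turns [1 + q^r] into odd factors), and its
logarithmic derivative gives [Mbar 1 k = k * pbar k], which vanishes modulo [p]
as soon as [p] divides [k]. *)

Import GRing.Theory Num.Theory.
Local Open Scope ring_scope.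

Local Notation eqX := Defs.eqX.

Lemma coef_eqX n (p q : {poly int}) :
  (forall i, (i <= n)%N -> p`_i = q`_i) -> eqX n p q.
Proof.
move=> pq; exists (drop_poly n.+1 (p - q)).
rewrite -[LHS](poly_take_drop n.+1).
suff -> : take_poly n.+1 (p - q) = 0 by rewrite add0r.
apply/polyP => i; rewrite coef_take_poly coef0 ltnS.
by case: ifP => // /pq e; rewrite coefB e subrr.
Qed.

(** The factor ['X] restores the degree lost by differentiation, so the precision [n] is kept. *)
Lemma eqX_Xderiv n (p q : {poly int}) :
  eqX n p q -> eqX n ('X * p^`()) ('X * q^`()).
Proof.
move=> pq; apply: coef_eqX => -[|i] le_in; rewrite !coefXM //= !coef_deriv.
by rewrite (Defs.eqX_coef pq le_in).
Qed.

Lemma coef0_prod_subX (I : Type) (s : seq I) (P : pred I) (e : I -> nat)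
    (c : I -> nat) : (forall i, P i -> 0 < e i)%N ->
  (\prod_(i <- s | P i) (1 - 'X^(e i) : {poly int}) ^+ c i)`_0 = 1.
Proof.
move=> e_gt0; rewrite -horner_coef0 horner_prod big1 // => i /e_gt0.
by case: (e i) => // k _; rewrite !hornerE expr0n /= subr0 expr1n.
Qed.

Lemma prod_even_nat (N : nat) (F : nat -> {poly int}) :
  \prod_(1 <= r < N.*2.+1 | ~~ odd r) F r = \prod_(1 <= r < N.+1) F r.*2.
Proof.
rewrite big_mkcond /=; elim: N => [|N IH]; first by rewrite !big_geq.
rewrite [RHS]big_nat_recr //= doubleS -IH.
by rewrite big_nat_recr // big_nat_recr //= odd_double mulr1.
Qed.

Lemma eqX_odd_distinct (N : nat) :
  eqX N (\prod_(1 <= r < N.+1) (1 + 'X^r) *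
         \prod_(1 <= r < N.+1 | odd r) (1 - 'X^r)) 1.
Proof.
(* Multiplying by the missing even factors completes the product of all [1 - 'X^r], which pairs with
   [1 + 'X^r] to give [1 - 'X^(r.*2)]. *)
apply: (@Defs.eqX_cancel _ _ _ (\prod_(1 <= r < N.+1 | ~~ odd r) (1 - 'X^r))).
  rewrite big_nat_cond.
  by apply: (@coef0_prod_subX _ _ _ id (fun=> 1%N)) => i /andP[/andP[]].
rewrite -mulrA.
have <- : \prod_(1 <= r < N.+1) (1 - 'X^r) =
    \prod_(1 <= r < N.+1 | odd r) (1 - 'X^r) *
    \prod_(1 <= r < N.+1 | ~~ odd r) (1 - 'X^r) :> {poly int}.
  exact: bigID.
rewrite -big_split /= mul1r.
under eq_bigr => r _.
  rewrite mulrC -subr_sqr expr1n -exprM muln2.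
  over.
(* Both sides are now products of [1 - 'X^r] over even [r], up to [N.*2] and up to [N]; the factors
   with [r > N] are 1 at precision [N]. *)
rewrite -(prod_even_nat N (fun r => 1 - 'X^r)) big_mkcond
  [X in eqX _ _ X]big_mkcond /=.
apply: Defs.eqX_cut; first by rewrite -addnn leq_addr.
move=> r lt_Nr; case: ifP => _; last exact: Defs.eqX_refl.
by exists (- 'X^(r - N.+1)); rewrite mulNr -exprD subnK // addrC addKr.
Qed.

Definition pbar_poly (N : nat) : {poly int} := \poly_(i < N.+1) (pbar i)%:R.

Definition euler_den (N : nat) : {poly int} :=
  \prod_(1 <= r < N.+1) (1 - 'X^r) ^+ cexp r.

(** By Euler's identity, the numerator of [pbar_genfun] is the inverse of the odd factors; moved to
    the denominator, these give odd [r] the exponent 2. *)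
Lemma pbar_euler_product (N : nat) : eqX N (pbar_poly N * euler_den N) 1.
Proof.
have -> : euler_den N = \prod_(1 <= r < N.+1) (1 - 'X^r) *
                        \prod_(1 <= r < N.+1 | odd r) (1 - 'X^r).
  rewrite [X in _ * X]big_mkcond -big_split /=; apply: eq_bigr => r _.
  by rewrite /cexp; case: odd; rewrite ?mulr1 ?expr1 ?expr2.
rewrite mulrA; apply: Defs.eqX_trans (eqX_odd_distinct N).
apply: Defs.eqX_mul; last exact: Defs.eqX_refl.
by apply: coef_eqX => i; apply: pbar_genfun.
Qed.

(* [l] is minus the logarithmic derivative [q f' / f], modulo [q^n.+1]. *)
Definition neg_dlog n (f l : {poly int}) := eqX n ('X * f^`()) (- (f * l)).

Lemma neg_dlog1 n : neg_dlog n 1 0.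
Proof. by rewrite /neg_dlog derivC !mulr0 oppr0; apply: Defs.eqX_refl. Qed.

Lemma neg_dlogM n f l g m :
  neg_dlog n f l -> neg_dlog n g m -> neg_dlog n (f * g) (l + m).
Proof.
case=> s es [t et]; exists (s * g + f * t); rewrite derivM.
have -> : (s * g + f * t) * 'X^(n.+1) = (s * 'X^(n.+1)) * g + f * (t * 'X^(n.+1)).
  by ring.
by rewrite -es -et; ring.
Qed.

Lemma neg_dlogX n f l k : neg_dlog n f l -> neg_dlog n (f ^+ k) (l *+ k).
Proof.
move=> fl; elim: k => [|k IH]; first exact: neg_dlog1.
by rewrite exprS mulrS; apply: neg_dlogM.
Qed.

(** Geometric series: [r q^r / (1 - q^r)] is [r] times the sum of the [q^(r k)] over [k >= 1]. *)
Lemma neg_dlog_subX n r : (0 < r)%N ->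
  neg_dlog n (1 - 'X^r) ((\sum_(1 <= k < n.+1) 'X^(r * k)) *+ r).
Proof.
move=> r_gt0.
have tel : (1 - 'X^r) * \sum_(1 <= k < n.+1) 'X^(r * k)
         = 'X^r - 'X^(r * n.+1) :> {poly int}.
  elim: n => [|n IH]; first by rewrite big_geq // muln1 subrr mulr0.
  by rewrite big_nat_recr //= mulrDr IH (mulnS r n.+1) exprD; ring.
rewrite /neg_dlog mulrnAr tel derivB derivC derivXn sub0r mulrN mulrnAr -exprS.
rewrite prednK //; exists (- 'X^(r * n.+1 - n.+1) *+ r).
by rewrite mulrnAl mulNr -exprD subnK ?leq_pmull //; ring.
Qed.

(** Truncated Lambert series of [sigma_c 1], left as a double sum to match the factors of
    [euler_den]. *)
Definition sigma_poly (N : nat) : {poly int} :=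
  \sum_(1 <= r < N.+1) (\sum_(1 <= k < N.+1) 'X^(r * k)) *+ r *+ cexp r.

Lemma neg_dlog_euler_den N : neg_dlog N (euler_den N) (sigma_poly N).
Proof.
rewrite /euler_den /sigma_poly !big_nat.
elim/big_ind2: _ => [|f l g m|r /andP[r_gt0 _]]; first exact: neg_dlog1.
- exact: neg_dlogM.
- exact/neg_dlogX/neg_dlog_subX.
Qed.

Lemma coef_sigma_poly N d : (0 < d <= N)%N ->
  (sigma_poly N)`_d = (sigma_c 1 d)%:R.
Proof.
move=> /andP[d_gt0 le_dN].
have -> : sigma_c 1 d =
    (\sum_(1 <= r < N.+1) if (r %| d)%N then cexp r * r else 0)%N.
  rewrite -big_mkcond -big_filter /sigma_c.
  under eq_bigr => r _ do rewrite expn1.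
  apply: perm_big; apply: uniq_perm; rewrite ?divisors_uniq //.
    by rewrite filter_uniq // iota_uniq.
  move=> r; rewrite mem_filter mem_index_iota -dvdn_divisors // ltnS.
  case r_d: (r %| d)%N => //=.
  by rewrite (dvdn_gt0 d_gt0 r_d) (leq_trans (dvdn_leq d_gt0 r_d)).
rewrite /sigma_poly coef_sum natr_sum; apply: eq_big_nat => r /andP[r_gt0 _].
rewrite !coefMn coef_sum.
(* Only [k = d / r] can contribute, and it lies in the range because [d <= N]. *)
suff -> : \sum_(1 <= k < N.+1) ('X^(r * k) : {poly int})`_d = (r %| d)%:R.
  by case: ifP; rewrite ?mul0rn // -mulrnA mulnC.
case: (boolP (r %| d)%N) => [/dvdnP[k def_d]|r_d]; last first.
  rewrite big1 // => k _; rewrite coefXn.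
  by case: eqP r_d => // ->; rewrite dvdn_mulr.
have k_gt0 : (0 < k)%N by case: (k) def_d d_gt0 => // ->.
have le_kN : (k <= N)%N by rewrite (leq_trans _ le_dN) // def_d leq_pmulr.
rewrite (bigD1_seq k) ?iota_uniq ?mem_index_iota ?k_gt0 //=.
rewrite coefXn def_d mulnC eqxx big1 ?addr0 // => j /negPf j_k.
by rewrite coefXn eqn_pmul2l // eq_sym j_k.
Qed.

(** With [G F = 1] and [q F' = - F L], the Leibniz rule gives [q G' F = L G F]; then [F] is
    cancelled, its constant term being 1. *)
Lemma eqX_dlog_pbar N :
  eqX N ('X * (pbar_poly N)^`()) (sigma_poly N * pbar_poly N).
Proof.
have F0 : (euler_den N)`_0 = 1.
  rewrite /euler_den big_nat_cond.
  by apply: (@coef0_prod_subX _ _ _ id) => i /andP[/andP[]].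
apply: (Defs.eqX_cancel F0).
have [s] := eqX_Xderiv _ _ _ (pbar_euler_product N).
have [t] := neg_dlog_euler_den N.
rewrite derivM derivC mulr0 subr0.
move: (pbar_poly N) (euler_den N) (sigma_poly N) => G F L et es.
exists (s - G * t).
by rewrite mulrBl -es -[_ * t * _]mulrA -et; ring.
Qed.

Lemma Mbar1 n : Mbar 1 n = (n * pbar n)%N.
Proof.
have := Defs.eqX_coef (eqX_dlog_pbar n) (leqnn n).
have -> : ('X * (pbar_poly n)^`())`_n = (n * pbar n)%:R.
  rewrite coefXM; case: n => [|n] //=.
  by rewrite coef_deriv coef_poly leqnn mulnC natrM mulr_natr.
(* The convolution starts at [d = 0] but [Mbar] at [d = 1]. *)
have sigma0 : (sigma_poly n)`_0 = 0.
  rewrite coef_sum big_nat big1 // => r /andP[r_gt0 _].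
  rewrite !coefMn coef_sum big_nat big1 ?mul0rn // => k /andP[k_gt0 _].
  by rewrite coefXn eq_sym muln_eq0 !eqn0Ngt r_gt0 k_gt0.
rewrite coefM big_ord_recl /= sigma0 mul0r add0r => /eqP.
rewrite /Mbar big_add1 big_mkord /=.
under eq_bigr => j _.
  rewrite coef_sigma_poly /bump ?add1n ?ltn_ord // coef_poly ltnS leq_subr.
  rewrite -natrM.
  over.
by rewrite -natr_sum eqr_nat => /eqP.
Qed.

Local Close Scope ring_scope.

(** Each block of [p.-1] factors is absorbed through [r ^ p = r]; the successor keeps the exponent
    positive, so multiples of [p] are covered too. *)
Lemma expn_modp p k r : prime p -> r ^ (k * p.-1).+1 = r %[mod p].
Proof.
move=> p_pr; elim: k => [|k IH]; first by rewrite expn1.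
rewrite mulSn -addnS expnD -modnMmr IH modnMmr -expnSr prednK ?prime_gt0 //.
by rewrite fermat_little.
Qed.

Lemma Mbar_modp p k m n : prime p -> m = (k * p.-1).+1 ->
  Mbar m (p * n) = 0 %[mod p].
Proof.
move=> p_pr ->.
have -> : Mbar (k * p.-1).+1 (p * n) = Mbar 1 (p * n) %[mod p].
  rewrite /Mbar; elim/big_ind2: _ => // [a b c d ab cd|d _].
    by rewrite -modnDm ab cd modnDm.
  rewrite -modnMml -[RHS]modnMml; congr (_ * _ %% _).
  rewrite /sigma_c; elim/big_ind2: _ => // [a b c e ab ce|r _].
    by rewrite -modnDm ab ce modnDm.
  by rewrite -modnMmr expn_modp // modnMmr expn1.
by rewrite Mbar1 -mulnA modnMr mod0n.
Qed.

Theorem theorem6p6 (n : nat) :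
  [/\ Mbar 5 (5 * n) = 0 %[mod 5],
      Mbar 7 (7 * n) = 0 %[mod 7],
      Mbar 11 (11 * n) = 0 %[mod 11] &
      Mbar 13 (13 * n) = 0 %[mod 13]]
  /\ (Mbar 9 (5 * n) = 0 %[mod 5] /\ Mbar 13 (7 * n) = 0 %[mod 7]).
Proof.
(* Here [m = p], hence [k = 1]; below, [9 = 2 * 4 + 1] and [13 = 2 * 6 + 1], hence [k = 2]. *)
split; first by split; apply: (@Mbar_modp _ 1).
by split; apply: (@Mbar_modp _ 2).
Qed.
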